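(* Each of the following complete multipartite graphs is dimension-critical: (i) the complete graph $K_{\alpha}$ for every integer $\alpha \geq 3$; (ii) the cycle $C_4$; (iii) the star $K_{1,3}$; (iv) the complete bipartite graph $K_{2,3}$; (v) $G(\alpha,0,\gamma)$ for all integers $\alpha \geq 0$ and $\gamma \geq 2$.
   Context: All graphs are finite and simple. A graph $G$ is representable (embeddable) in $\mathbb{R}^n$ if its vertices can be placed at distinct points of $\mathbb{R}^n$ so that any two adjacent vertices are at Euclidean distance exactly 1 (non-adjacent vertices are also allowed to be at distance 1). By convention, $\mathbb{R}^0$ is a single point. The dimension $\dim(G)$ is the smallest integer $n \ge 0$ such that $G$ is representable in $\mathbb{R}^n$. A non-empty graph $G$ is dimension-critical if every proper subgraph $H$ of $G$ (not necessarily induced) satisfies $\dim(H) < \dim(G)$. For non-negative integers $\alpha,\beta,\gamma$, $G(\alpha,\beta,\gamma)$ denotes the complete multipartite graph with $\alpha+\beta+\gamma$ parts, of which $\alpha$ have size 1, $\beta$ have size 2, and $\gamma$ have size 3. *)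

(* Defs.v *)
From HB Require Import structures.
From mathcomp Require Import all_boot all_order all_algebra.
From mathcomp Require Import boolp reals.

Set Implicit Arguments.
Unset Strict Implicit.
Unset Printing Implicit Defensive.

Import Order.TTheory GRing.Theory Num.Theory.
Local Open Scope ring_scope.

(* Finite simple graphs whose vertices are taken among the elements of a finite
   type T.  The vertex set is a field, so that a graph and all its subgraphs
   (induced or not) have the same type. *)
Record graph (T : finType) := Graph {
  vertices : {set T};
  adj : rel T;
  adj_sym : symmetric adj;
  adj_irrefl : irreflexive adj;
  adj_vertices : forall x y, adj x y -> (x \in vertices) && (y \in vertices)
}.

(* The graph with no vertices is a subgraph of every graph. *)
Definition subgraph (T : finType) (H G : graph T) : Prop :=
  vertices H \subset vertices G /\ subrel (adj H) (adj G).

Definition proper_subgraph (T : finType) (H G : graph T) : Prop :=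
  subgraph H G /\ ~ (vertices H = vertices G /\ adj H =2 adj G).

(* The norm that MathComp-Analysis puts on 'rV[R]_n is the sup norm, hence the
   explicit formula. *)
Definition edist (R : realType) (n : nat) (u v : 'rV[R]_n) : R :=
  Num.sqrt (\sum_(i < n) (u ord0 i - v ord0 i) ^+ 2).

Definition representable (R : realType) (T : finType) (G : graph T) (n : nat)
    : Prop :=
  exists f : T -> 'rV[R]_n,
    {in vertices G &, injective f} /\
    forall x y, adj G x y -> edist (f x) (f y) = 1.

(* The points e_x / sqrt 2 are pairwise at distance 1. *)
Lemma ex_representable (R : realType) (T : finType) (G : graph T) :
  exists n, `[< representable R G n >].
Proof.
exists #|T|; apply/asboolP.
pose c : R := Num.sqrt 2^-1.
have c2 : c ^+ 2 = 2^-1 by rewrite sqr_sqrtr // invr_ge0 ler0n.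
have c0 : c != 0 by rewrite sqrtr_eq0 -ltNge invr_gt0 ltr0n.
pose f (x : T) : 'rV[R]_#|T| := \row_i (c *+ (i == enum_rank x)).
exists f; split=> [x y _ _ /rowP/(_ (enum_rank x))|x y exy].
  rewrite !mxE eqxx; case: eqVneq => [/enum_rank_inj //|_ /eqP].
  by rewrite mulr1n mulr0n (negPf c0).
have nxy : enum_rank y != enum_rank x.
  apply/eqP => /enum_rank_inj yx.
  by move: exy; rewrite yx adj_irrefl.
rewrite /edist (bigD1 (enum_rank x)) //= (bigD1 (enum_rank y)) //=.
rewrite big1 => [|i /andP[ix iy]].
  by rewrite !mxE !eqxx (negPf nxy) eq_sym (negPf nxy) subr0 sub0r sqrrN c2
     addr0 -mulr2n -(mulr_natr 2^-1) mulVf ?sqrtr1 // pnatr_eq0.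
by rewrite !mxE (negPf ix) (negPf iy) subrr expr0n.
Qed.

Definition dim (R : realType) (T : finType) (G : graph T) : nat :=
  ex_minn (ex_representable R G).

Definition dimension_critical (R : realType) (T : finType) (G : graph T)
    : Prop :=
  vertices G != set0 /\
  forall H : graph T, proper_subgraph H G -> (dim R H < dim R G)%N.

Section Spanning.
Variables (T : finType) (e : rel T).
Hypotheses (e_sym : symmetric e) (e_irrefl : irreflexive e).

Lemma spanning_vertices (x y : T) :
  e x y -> (x \in [set: T]) && (y \in [set: T]).
Proof. by rewrite !inE. Qed.

Definition spanning_graph : graph T := Graph e_sym e_irrefl spanning_vertices.
End Spanning.

Definition complete_adj (n : nat) : rel 'I_n := fun i j => i != j.
Lemma complete_sym n : symmetric (@complete_adj n).
Proof. by move=> i j; rewrite /complete_adj eq_sym. Qed.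
Lemma complete_irrefl n : irreflexive (@complete_adj n).
Proof. by move=> i; rewrite /complete_adj eqxx. Qed.
Definition complete_graph (n : nat) : graph 'I_n :=
  spanning_graph (@complete_sym n) (@complete_irrefl n).

Definition cycle_adj (n : nat) : rel 'I_n := fun i j =>
  (i != j) && ((j == i.+1 %% n :> nat)%N || (i == j.+1 %% n :> nat)%N).
Lemma cycle_sym n : symmetric (@cycle_adj n).
Proof. by move=> i j; rewrite /cycle_adj eq_sym orbC. Qed.
Lemma cycle_irrefl n : irreflexive (@cycle_adj n).
Proof. by move=> i; rewrite /cycle_adj eqxx. Qed.
Definition cycle_graph (n : nat) : graph 'I_n :=
  spanning_graph (@cycle_sym n) (@cycle_irrefl n).

(* The parts are indexed by I, the part of index i has size p i, and its k-th
   vertex is the dependent pair (i, k). *)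
Section Multipartite.
Variables (I : finType) (p : I -> nat).
Definition multipartite_adj : rel {i : I & 'I_(p i)} :=
  fun x y => tag x != tag y.
Lemma multipartite_sym : symmetric multipartite_adj.
Proof. by move=> x y; rewrite /multipartite_adj eq_sym. Qed.
Lemma multipartite_irrefl : irreflexive multipartite_adj.
Proof. by move=> x; rewrite /multipartite_adj eqxx. Qed.
Definition complete_multipartite : graph {i : I & 'I_(p i)} :=
  spanning_graph multipartite_sym multipartite_irrefl.
End Multipartite.

Definition complete_bipartite (m n : nat) :=
  complete_multipartite (fun b : bool => if b then n else m).

(* G(a, b, c): a parts of size 1, b parts of size 2 and c parts of size 3. *)
Definition part_size_123 (a b c : nat) (i : 'I_a + 'I_b + 'I_c) : nat :=
  match i with
  | inl (inl _) => 1
  | inl (inr _) => 2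
  | inr _ => 3
  end.
Definition multipartite_123 (a b c : nat) := complete_multipartite (@part_size_123 a b c).

(* Main.v *)
(* Every proper subgraph misses an edge, so it is enough to bound below the
   dimension of each graph G and to embed every G - e in a smaller dimension.

   For G(alpha, 0, gamma) the lower bound is alpha + 2 gamma.  Unit distances
   make differences taken in distinct parts orthogonal, and the three points of
   a triple, lying on a sphere, span a plane.  The circumradii r, r' and the
   circumcenters c, c' of two triples satisfy |c - c'|^2 = 1 - r^2 - r'^2, so
   that some triple has r^2 <= 1/2.  An affine combination of the singletons is
   at squared distance > 1/2 from each point of that triple, so it cannot be its
   circumcenter, and the singletons contribute alpha further independent
   directions.

   Conversely, if the vertices of G - e are coloured properly with at most two
   vertices per colour, then N colours give an embedding in R^N, the colour
   classes being pairs of opposite points +- e_i / sqrt 2.  The deleted edge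
   provides a colour class of a new kind, which saves one colour. *)
Require Import Defs.
From mathcomp Require Import all_boot all_order all_algebra.
From mathcomp Require Import boolp reals.
From mathcomp Require Import ring lra zify.

Set Implicit Arguments.
Unset Strict Implicit.
Unset Printing Implicit Defensive.

Import Order.TTheory GRing.Theory Num.Theory.
Local Open Scope ring_scope.

(** * Reduction to deleting a single edge *)

Definition unit_off_edge (R : realType) (T : finType) (G : graph T) (x y : T)
    (n : nat) (f : T -> 'rV[R]_n) : Prop :=
  forall u v, adj G u v -> (u, v) != (x, y) -> (u, v) != (y, x) ->
  edist (f u) (f v) = 1.

(** A proper subgraph on all the vertices lacks an edge; one that misses a vertex lacks the edges
    there, and [noiso] provides one. The embedding of [G] minus that edge then serves for the
    subgraph. *)
Lemma dimension_critical_of_edges (R : realType) (T : finType) (G : graph T)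
    (N : nat) :
  vertices G != set0 ->
  (forall x, x \in vertices G -> exists y, adj G x y) ->
  (forall m, representable R G m -> (N <= m)%N) ->
  (forall x y, adj G x y -> exists n, (n < N)%N /\
     exists f : T -> 'rV[R]_n, injective f /\ unit_off_edge G x y f) ->
  dimension_critical R G.
Proof.
move=> G0 noiso lowG edgeG; split=> // H [[sV sE] neqHG].
have dimG : (N <= Defs.dim R G)%N.
  by rewrite /Defs.dim; case: ex_minnP => m /asboolP /lowG.
suff [x [y [xy nxy]]] : exists x y, adj G x y /\ ~~ adj H x y.
  have [n [nN [f [f_inj fE]]]] := edgeG x y xy.
  apply: leq_ltn_trans (leq_trans nN dimG).
  rewrite /Defs.dim; case: ex_minnP => m _; apply; apply/asboolP.
  exists f; split=> [u v _ _|u v uv]; first exact: f_inj.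
  apply: fE; first exact: sE.
  - by apply: contraNneq nxy => -[<- <-].
  - by apply: contraNneq nxy => -[<- <-]; rewrite adj_sym.
have [VHG|VHG] := eqVneq (vertices H) (vertices G).
  apply: contrapT => nex; apply: neqHG; split=> // x y.
  apply/idP/idP => [|xy]; first exact: sE.
  by apply: contrapT => /negP nxy; apply: nex; exists x, y.
have : vertices H \proper vertices G by rewrite properEneq VHG.
case/properP => _ [x /noiso[y xy] xH]; exists x, y; split=> //.
by apply: contraNN xH => /adj_vertices /andP[].
Qed.

Lemma sum_sqr_eq0 (R : realDomainType) (I : finType) (l : I -> R) :
  \sum_i l i ^+ 2 = 0 -> forall i, l i = 0.
Proof.
move/eqP; rewrite psumr_eq0 => [/allP l0 i|i _]; last exact: sqr_ge0.
by apply/eqP; have := l0 i (mem_index_enum i); rewrite /= sqrf_eq0.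
Qed.

(** * Inner products, unit distances and simplices *)

Section Dot.
Variables (R : realType) (n : nat).
Implicit Types (u v w p q : 'rV[R]_n).

Definition dot u v : R := \sum_i u ord0 i * v ord0 i.

Lemma dotC u v : dot u v = dot v u.
Proof. by apply: eq_bigr => i _; rewrite mulrC. Qed.

Lemma dotDl u v w : dot (u + v) w = dot u w + dot v w.
Proof. by rewrite -big_split; apply: eq_bigr => i _; rewrite mxE mulrDl. Qed.

Lemma dotZl c u v : dot (c *: u) v = c * dot u v.
Proof. by rewrite big_distrr; apply: eq_bigr => i _; rewrite mxE /= mulrA. Qed.

Lemma dotNl u v : dot (- u) v = - dot u v.
Proof. by rewrite -scaleN1r dotZl mulN1r. Qed.

Lemma dot0l u : dot 0 u = 0.
Proof. by rewrite -(scale0r 0) dotZl mul0r. Qed.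

Lemma dotDr u v w : dot w (u + v) = dot w u + dot w v.
Proof. by rewrite !(dotC w) dotDl. Qed.

Lemma dotZr c u v : dot u (c *: v) = c * dot u v.
Proof. by rewrite !(dotC u) dotZl. Qed.

Lemma dotNr u v : dot u (- v) = - dot u v.
Proof. by rewrite !(dotC u) dotNl. Qed.

Definition dotE := (dotDl, dotDr, dotNl, dotNr, dotZl, dotZr).

Lemma dot_spanr s t u v w :
  dot w (s *: u + t *: v) = s * dot w u + t * dot w v.
Proof. by rewrite dotDr !dotZr. Qed.

Lemma dot_spanl s t u v w :
  dot (s *: u + t *: v) w = s * dot u w + t * dot v w.
Proof. by rewrite dotDl !dotZl. Qed.

Lemma dot_suml (I : finType) (Q : pred I) (F : I -> 'rV[R]_n) v :
  dot (\sum_(i | Q i) F i) v = \sum_(i | Q i) dot (F i) v.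
Proof.
by elim/big_rec2: _ => [|i a b _ <-]; rewrite ?dot0l ?dotDl.
Qed.

Lemma dot_sumr (I : finType) (Q : pred I) (F : I -> 'rV[R]_n) v :
  dot v (\sum_(i | Q i) F i) = \sum_(i | Q i) dot v (F i).
Proof. by rewrite dotC dot_suml; apply: eq_bigr => i _; rewrite dotC. Qed.

Lemma dot_ge0 u : 0 <= dot u u.
Proof. by apply: sumr_ge0 => i _; rewrite -expr2 sqr_ge0. Qed.

Lemma dot_eq0 u : (dot u u == 0) = (u == 0).
Proof.
apply/idP/eqP => [|->]; last by rewrite dot0l.
rewrite psumr_eq0 => [/allP u0|i _]; last by rewrite -expr2 sqr_ge0.
apply/rowP => i; rewrite mxE; apply/eqP.
by have := u0 i (mem_index_enum i); rewrite /= mulf_eq0 orbb.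
Qed.

Lemma edist1P u v : edist u v = 1 <-> dot (u - v) (u - v) = 1.
Proof.
have -> : dot (u - v) (u - v) = \sum_(i < n) (u ord0 i - v ord0 i) ^+ 2.
  by apply: eq_bigr => i _; rewrite !mxE expr2.
rewrite /edist; split=> [e1|->]; last by rewrite sqrtr1.
rewrite -[LHS]sqr_sqrtr ?e1 ?expr1n //.
by apply: sumr_ge0 => i _; rewrite sqr_ge0.
Qed.

Lemma card_free_family (I : finType) (F : I -> 'rV[R]_n) :
  (forall l : I -> R, \sum_i l i *: F i = 0 -> forall i, l i = 0) ->
  (#|I| <= n)%N.
Proof.
move=> freeF; pose A := \matrix_(i < #|I|) F (enum_val i).
suff /eqP <- : row_free A by exact: rank_leq_col.
rewrite -kermx_eq0; apply/rowV0P => v /sub_kermxP vA0; apply/rowP => k.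
have := freeF (fun i => v ord0 (enum_rank i)) _ (enum_val k).
rewrite enum_valK mxE; apply.
rewrite (reindex (@enum_val _ I)) /=; last exact/onW_bij/enum_val_bij.
rewrite -{}[RHS]vA0 mulmx_sum_row; apply: eq_bigr => i _.
by rewrite enum_valK rowK.
Qed.

Definition sqdist1 p q := dot (p - q) (p - q) = 1.

(** The point [r] is equidistant from [p] and [q], so it projects to the midpoint of the segment. *)
Lemma edge_dot p q r : sqdist1 r p -> sqdist1 r q ->
  dot (r - p) (q - p) = dot (q - p) (q - p) / 2.
Proof.
rewrite /sqdist1 !dotE (dotC p r) (dotC q r) (dotC q p) => h1 h2; lra.
Qed.

(** In the alternating sum of the four squared distances all squared norms cancel. *)
Lemma square_orthogonal p p' q q' :
  sqdist1 p q -> sqdist1 p q' -> sqdist1 p' q -> sqdist1 p' q' ->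
  dot (p - p') (q - q') = 0.
Proof.
rewrite /sqdist1 !dotE (dotC q p) (dotC q' p) (dotC q p') (dotC q' p').
move=> h1 h2 h3 h4; lra.
Qed.

(* A line meets a sphere in at most two points. *)
Lemma triple_free x0 x1 x2 r s t :
  x1 != x0 -> x2 != x0 -> x1 != x2 ->
  sqdist1 r x0 -> sqdist1 r x1 -> sqdist1 r x2 ->
  s *: (x1 - x0) + t *: (x2 - x0) = 0 -> s = 0 /\ t = 0.
Proof.
move=> n10 n20 n12 r0 r1 r2; have := edge_dot r0 r1; have := edge_dot r0 r2.
have : x1 - x0 != x2 - x0.
  by apply: contraNneq n12 => /addIr ->.
move: n10 n20; rewrite -(subr_eq0 x1) -(subr_eq0 x2).
move: (x1 - x0) (x2 - x0) (r - x0) => u v w u0 v0 uv wv wu st.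
have [s0|s0] := eqVneq s 0.
  split=> //; move: st; rewrite s0 scale0r add0r => /eqP.
  by rewrite scaler_eq0 (negPf v0) orbF => /eqP.
have uE : u = (- (s^-1 * t)) *: v.
  apply: (scalerI s0); rewrite scalerA mulrN mulrA mulfV // mul1r scaleNr.
  by apply/eqP; rewrite -addr_eq0 st.
move: (- (s^-1 * t)) uE => c uE; move: wu; rewrite uE !dotE wv => h.
have vv : dot v v != 0 by rewrite dot_eq0.
(* Here [dot w u] is both [c / 2] and [c ^+ 2 / 2] times [dot v v]. The roots 0 and 1 make [x1]
   equal to [x0] or to [x2]. *)
have /eqP : c * (c - 1) = 0.
  apply: (mulIf vv); rewrite mul0r; lra.
rewrite mulf_eq0 subr_eq0 => /orP[] /eqP c1.
  by case/negP: u0; rewrite uE c1 scale0r.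
by case/negP: uv; rewrite uE c1 scale1r.
Qed.

(** The Gram matrix is that of the edges of a regular unit simplex at one vertex: half the sum of
    the all-ones matrix and the identity, whence the two terms. *)
Lemma simplex_dot (I : finType) (B : I -> 'rV[R]_n) (l : I -> R) :
  (forall i j, dot (B i) (B j) = (1 + (i == j)%:R) / 2) ->
  let S := \sum_i l i *: B i in
  dot S S = ((\sum_i l i) ^+ 2 + \sum_i l i ^+ 2) / 2.
Proof.
move=> BB /=; set M := \sum_i l i.
rewrite dot_suml; transitivity (\sum_i l i * (M + l i) / 2).
  apply: eq_bigr => i _; rewrite dotZl dot_sumr -mulrA; congr (_ * _).
  under eq_bigr => j _ do rewrite dotZr BB mulrA mulrDr mulr1.
  rewrite -mulr_suml big_split /= [X in _ + X](bigD1 i) //= eqxx mulr1.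
  rewrite [X in _ + (_ + X)]big1 ?addr0 //.
  by move=> j ji; rewrite eq_sym (negPf ji) mulr0.
rewrite -mulr_suml; congr (_ / _).
transitivity (\sum_i (l i * M + l i ^+ 2)).
  by apply: eq_bigr => i _; rewrite mulrDr.
by rewrite big_split /= -mulr_suml [M ^+ 2]expr2.
Qed.

Lemma simplex_free (I : finType) (B : I -> 'rV[R]_n) (l : I -> R) :
  (forall i j, dot (B i) (B j) = (1 + (i == j)%:R) / 2) ->
  let S := \sum_i l i *: B i in dot S S = 0 -> forall i, l i = 0.
Proof.
move=> BB /=; rewrite (simplex_dot _ BB) => /eqP.
rewrite mulf_eq0 invr_eq0 pnatr_eq0 orbF paddr_eq0 ?sqr_ge0 //; last first.
  by apply: sumr_ge0 => i _; apply: sqr_ge0.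
by case/andP => _ /eqP /sum_sqr_eq0.
Qed.

Lemma simplex_gram (I : finType) (a : I -> 'rV[R]_n) o :
  (forall i j, i != j -> sqdist1 (a i) (a j)) -> (forall i, sqdist1 (a i) o) ->
  forall i j, dot (a i - o) (a j - o) = (1 + (i == j)%:R) / 2.
Proof.
move=> aa ao i j; have [<-|ij] := eqVneq i j; first by rewrite ao /=; field.
by rewrite (edge_dot (ao i) (aa _ _ ij)) ao addr0.
Qed.

(* A witness [w] points from [x0] to the circumcenter of the triangle, and the
   circumradius exceeds 1 / sqrt 2. *)
Definition fat x0 x1 x2 := exists2 w : 'rV[R]_n,
  exists s t, w = s *: (x1 - x0) + t *: (x2 - x0) &
  [/\ dot w (x1 - x0) = dot (x1 - x0) (x1 - x0) / 2,
      dot w (x2 - x0) = dot (x2 - x0) (x2 - x0) / 2 & 1 / 2 < dot w w].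

(* Both circumcenters are in the span, and their squared distance would be
   [1 - r^2 - r'^2 < 0]. *)
Lemma joined_fat (x y : 'I_3 -> 'rV[R]_n) i1 i2 j1 j2 i0 j0 :
  (forall i j, sqdist1 (x i) (y j)) ->
  fat (x i0) (x i1) (x i2) -> fat (y j0) (y j1) (y j2) -> False.
Proof.
move=> xy [w [s [t wE]] [w1 w2 ww]] [z [s' [t' zE]] [z1 z2 zz]].
have yx i j : sqdist1 (y j) (x i).
  by have := xy i j; rewrite /sqdist1 -opprB dotNl dotNr opprK.
have wz : dot w z = 0.
  by rewrite wE zE dot_spanl !dot_spanr !square_orthogonal // !(mulr0, addr0).
pose D := y j0 - x i0.
have DD : dot D D = 1 by exact: yx.
have Dw : dot D w = dot w w.
  rewrite [X in dot D X]wE [X in dot w X]wE !dot_spanr w1 w2.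
  by rewrite !(edge_dot (yx _ _) (yx _ _)).
have Dz : dot D z = - dot z z.
  rewrite [X in dot D X]zE [X in dot z X]zE !dot_spanr z1 z2.
  by rewrite /D -opprB !dotNl !(edge_dot (xy _ _) (xy _ _)) !mulrN -opprD.
(* The vector [D - w + z] joins the two circumcenters. *)
clearbody D; have := dot_ge0 (D - w + z).
rewrite !dotE (dotC w D) (dotC z D) (dotC z w) DD Dw Dz wz => h.
clear wE zE; lra.
Qed.
End Dot.

(** * Lower bound for singletons and triples *)

Section Bound.
Variables (R : realType) (n alpha gamma : nat).
Variables (a : 'I_alpha -> 'rV[R]_n) (x : 'I_gamma -> 'I_3 -> 'rV[R]_n).
Hypotheses (aa : forall i j, i != j -> sqdist1 (a i) (a j))
  (ax : forall i j k, sqdist1 (a i) (x j k))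
  (xx : forall i j k l, i != j -> sqdist1 (x i k) (x j l))
  (x_inj : forall i, injective (x i)).

Let k0 : 'I_3 := ord0.
Let k1 : 'I_3 := lift ord0 ord0.
Let k2 : 'I_3 := ord_max.
Let d j k := x j k - x j k0.

(* The differences within the triples together with the [a j - x i0 k0] are
   linearly independent. *)
Lemma not_fat_bound i0 i' : i' != i0 ->
  ~ fat (x i0 k0) (x i0 k1) (x i0 k2) -> (alpha + gamma * 2 <= n)%N.
Proof.
move=> i'0 nfat.
pose F (i : 'I_alpha + 'I_gamma * bool) := match i with
  | inl j => a j - x i0 k0 | inr (j, b) => d j (if b then k1 else k2) end.
suff : (#|{: 'I_alpha + 'I_gamma * bool}| <= n)%N.
  by rewrite card_sum card_prod !card_ord card_bool.
apply: (@card_free_family R n _ F) => l; rewrite big_sumType /=.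
pose s j := l (inr (j, true)); pose t j := l (inr (j, false)).
pose P j := s j *: d j k1 + t j *: d j k2.
have -> : \sum_(p : 'I_gamma * bool) l (inr p) *: F (inr p) = \sum_j P j.
  pose H j b := l (inr (j, b)) *: d j (if b then k1 else k2).
  rewrite (eq_bigr (fun p => H p.1 p.2)); last by case.
  by rewrite -(pair_bigA _ H); apply: eq_bigr => j _; rewrite big_bool.
set S := \sum_i _ => SP0.
have free j : P j = 0 -> s j = 0 /\ t j = 0.
  (* A triple lies on the unit sphere around a vertex of another triple; for [i0] that vertex comes
     from [i']. *)
  have [r [r0 r1 r2]] : exists r, [/\ sqdist1 r (x j k0),
      sqdist1 r (x j k1) & sqdist1 r (x j k2)].
    have [->|ij] := eqVneq j i0; first by exists (x i' k0); split; apply: xx.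
    by exists (x i0 k0); split; apply: xx; rewrite eq_sym.
  by apply: triple_free r0 r1 r2; rewrite (inj_eq (@x_inj j)).
have Pd j j' k : j != j' -> dot (P j) (d j' k) = 0.
  move=> jj'; rewrite dot_spanl !square_orthogonal ?mulr0 ?addr0 //;
  exact: xx.
have PP j j' : j != j' -> dot (P j) (P j') = 0.
  by move=> jj'; rewrite [P j']/P dot_spanr !Pd // !mulr0 addr0.
have Sd j k : j != i0 -> dot S (d j k) = 0.
  move=> ji; rewrite dot_suml big1 // => i _.
  by rewrite dotZl square_orthogonal ?mulr0 //; apply: xx; rewrite eq_sym.
(* Pairing the relation [SP0] with [P j] leaves only [dot (P j) (P j)]. *)
have P0 j : j != i0 -> P j = 0.
  move=> ji; apply/eqP; rewrite -dot_eq0.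
  have := congr1 (fun v => dot v (P j)) SP0.
  rewrite dot0l dotDl (bigD1 j) //= dotDl.
  rewrite {1}[P j]/P dot_spanr !Sd // !mulr0 !add0r dot_suml big1 ?addr0.
    by move=> ->.
  by move=> i ij; rewrite PP.
have SE : S = - P i0.
  apply/eqP; rewrite -addr_eq0 -SP0 (bigD1 i0) //= big1 ?addr0 //.
pose M := \sum_i l (inl i).
have gram := simplex_gram aa (fun i => ax i i0 k0).
have SS : dot S S = (M ^+ 2 + \sum_i l (inl i) ^+ 2) / 2.
  exact: simplex_dot.
have Sk k : dot S (d i0 k) = M * (dot (d i0 k) (d i0 k) / 2).
  rewrite dot_suml /M mulr_suml; apply: eq_bigr => i _.
  by rewrite dotZl (edge_dot (ax _ _ _) (ax _ _ _)).
have sq0 : 0 <= \sum_i l (inl i) ^+ 2 by apply: sumr_ge0 => i _; apply: sqr_ge0.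
(* Otherwise [x i0 k0 + M^-1 *: S] is an affine combination of the [a j] lying
   in the plane of the triple [x i0], hence its circumcenter, and it is too far
   from [x i0 k0]. *)
have M0 : M = 0.
  apply/eqP; apply: contrapT => /negP M0; apply: nfat.
  exists (M^-1 *: S).
    exists (- (M^-1 * s i0)), (- (M^-1 * t i0)).
    by rewrite SE /P scalerN scalerDr !scalerA opprD !scaleNr.
  split; rewrite !(dotZl, dotZr) ?Sk ?mulKf // SS.
  have -> : M^-1 * (M^-1 * ((M ^+ 2 + \sum_i l (inl i) ^+ 2) / 2)) =
      1 / 2 + (M^-1) ^+ 2 * (\sum_i l (inl i) ^+ 2) / 2 by field.
  rewrite ltrDl divr_gt0 // mulr_gt0 ?exprn_even_gt0 ?invr_eq0 //.
  rewrite lt_neqAle sq0 andbT eq_sym; apply: contraNneq M0 => /sum_sqr_eq0 l0.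
  by rewrite /M big1.
(* Since [M = 0], [Sk] makes [S] orthogonal to the plane of the triple [i0], which contains it by
   [SE]. *)
have S0 : dot S S = 0.
  by rewrite {2}SE dotNr /P dot_spanr !Sk M0 !mul0r !mulr0 addr0 oppr0.
have l0 i : l (inl i) = 0 by exact: (simplex_free gram S0).
have st j : s j = 0 /\ t j = 0.
  apply: free; have [->|/P0//] := eqVneq j i0.
  by apply/eqP; rewrite -oppr_eq0 -SE -dot_eq0 S0.
by move=> [i|[j []]]; [exact: l0 | case: (st j) | case: (st j)].
Qed.

(** Two triples cannot both be fat, so [not_fat_bound] applies to one of them, with the other as
    [i']. *)
Lemma multipartite_bound : (2 <= gamma)%N -> (alpha + gamma * 2 <= n)%N.
Proof.
move=> g2; pose i : 'I_gamma := Ordinal (ltnW g2); pose j := Ordinal g2.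
have ij : i != j by [].
have [fi|] := pselect (fat (x i k0) (x i k1) (x i k2)); last first.
  by apply: not_fat_bound (j) _; rewrite eq_sym.
apply: (@not_fat_bound j i ij) => fj.
by apply: (joined_fat _ fi fj) => k l; apply: xx.
Qed.
End Bound.

(** * Lower bounds two and three *)

Section SmallFree.
Variables (R : realType) (n : nat).
Implicit Types u v w : 'rV[R]_n.

Lemma free2 u v :
  (forall s t, s *: u + t *: v = 0 -> s = 0 /\ t = 0) -> (2 <= n)%N.
Proof.
move=> fr; rewrite -[X in (X <= _)%N]card_bool.
apply: (@card_free_family R n _ (fun b : bool => if b then u else v)) => l.
by rewrite big_bool /= => /fr[lt lf] [].
Qed.

Lemma free3 u v w :
  (forall s t, s *: u + t *: v = 0 -> s = 0 /\ t = 0) ->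
  dot w u = 0 -> dot w v = 0 -> w != 0 -> (3 <= n)%N.
Proof.
move=> fr wu wv w0; rewrite -[X in (X <= _)%N](_ : #|{: bool + unit}| = _).
  pose F (i : bool + unit) :=
    match i with inl b => if b then u else v | inr _ => w end.
  apply: (@card_free_family R n _ F) => l.
  rewrite big_sumType /= big_bool /= (big_pred1 tt) => [e|[]//].
  have lw : l (inr tt) = 0.
    have := congr1 (dot w) e; rewrite dotDr dot_spanr wu wv !mulr0 !add0r.
    rewrite dotZr dotC dot0l => /eqP.
    by rewrite mulf_eq0 dot_eq0 (negPf w0) orbF => /eqP.
  by move: e; rewrite lw scale0r addr0 => /fr[lt lf] [[]|[]].
by rewrite card_sum card_bool card_unit.
Qed.
End SmallFree.

(** * Embeddings from colourings *)

Section Frame.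
Variables (R : realType) (C : finType) (A : {set C}).

(** The standard basis, indexed by [A]; a colour outside [A] gives the zero vector. *)
Definition frame (c : C) : 'rV[R]_#|A| := \row_i (enum_val i == c)%:R.

Lemma dot_framel c v (cA : c \in A) :
  dot (frame c) v = v ord0 (enum_rank_in cA c).
Proof.
rewrite /dot (bigD1 (enum_rank_in cA c)) //= big1 => [|i ic].
  by rewrite !mxE enum_rankK_in // eqxx mul1r addr0.
rewrite !mxE; case: eqP => [e|]; last by rewrite mul0r.
by case/eqP: ic; apply: enum_val_inj; rewrite enum_rankK_in.
Qed.

Lemma dot_frame c c' : c \in A -> dot (frame c) (frame c') = (c == c')%:R.
Proof. by move=> cA; rewrite (dot_framel _ cA) !mxE enum_rankK_in. Qed.

Lemma dot_frame_const c t : c \in A -> dot (frame c) (const_mx t) = t.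
Proof. by move=> cA; rewrite (dot_framel _ cA) mxE. Qed.

Lemma dot_const (t : R) :
  dot (const_mx t) (const_mx t : 'rV_#|A|) = t ^+ 2 *+ #|A|.
Proof.
rewrite /dot (eq_bigr (fun=> t ^+ 2)) ?sumr_const ?card_ord // => i _.
by rewrite !mxE expr2.
Qed.

Lemma half_sqrt : exists2 h : R, h * h = 1 / 2 & 0 < h.
Proof.
exists (Num.sqrt (1 / 2)); last by rewrite sqrtr_gt0 divr_gt0.
by rewrite -expr2 sqr_sqrtr // divr_ge0.
Qed.

(* Vertices sharing a colour are sent to opposite vertices of a cross-polytope
   with edges of length 1. *)
Lemma two_per_colour (T : finType) (col : T -> C) (sg : T -> bool) :
  (forall v, col v \in A) ->
  (forall u v, col u = col v -> sg u = sg v -> u = v) ->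
  exists f : T -> 'rV[R]_#|A|, injective f /\
    forall u v, col u != col v -> edist (f u) (f v) = 1.
Proof.
move=> colA inj; have [h hh h0] := half_sqrt.
pose f v := ((-1) ^+ sg v * h) *: frame (col v).
have sq (b : bool) : ((-1) ^+ b * h) * ((-1) ^+ b * h) = 1 / 2.
  by rewrite mulrACA hh -signr_addb addbb [LHS]mul1r.
have fE u v : col u != col v -> dot (f u - f v) (f u - f v) = 1.
  move=> uv; rewrite !dotE !dot_frame // !eqxx (eq_sym (col v)) (negPf uv).
  rewrite !mulr0 !mulr1 !sq; lra.
exists f; split=> [u v fuv|u v /fE]; last by move=> ?; apply/edist1P.
have uv : col u = col v.
  apply/eqP; apply: contraT => /fE; rewrite fuv subrr dot0l => /eqP.
  by rewrite eq_sym oner_eq0.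
apply: inj => //; have := congr1 (dot (frame (col v))) fuv.
rewrite /f uv !dotZr dot_frame // eqxx !mulr1 => /(mulIf (lt0r_neq0 h0)).
by case: (sg u) (sg v) => [] [] //= e; exfalso; lra.
Qed.
End Frame.

Lemma unit_off_edge_sym (R : realType) (T : finType) (G : graph T) x y n
    (f : T -> 'rV[R]_n) :
  unit_off_edge G x y f -> unit_off_edge G y x f.
Proof. by move=> fE u v uv xy yx; apply: fE. Qed.

Lemma representable_spanning (R : realType) (T : finType) (G : graph T) m :
  vertices G = setT -> representable R G m ->
  exists f : T -> 'rV[R]_m, injective f /\
    forall x y, adj G x y -> sqdist1 (f x) (f y).
Proof.
move=> VG [f [fi fE]]; exists f; split=> [x y|x y /fE /edist1P //].
by apply: fi; rewrite VG inE.
Qed.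

(** * Complete graphs *)

(** The edges at one vertex are independent. Without the edge [x y], the other vertices form a
    regular simplex on the coordinate axes, and [x] and [y] are its two apexes on the diagonal. *)
Lemma complete_critical (R : realType) (n : nat) :
  dimension_critical R (complete_graph n.+3).
Proof.
apply: (@dimension_critical_of_edges _ _ _ n.+2).
- by apply/set0Pn; exists ord0; rewrite inE.
- move=> x _; have [->|x0] := eqVneq x ord0; first by exists ord_max.
  by exists ord0.
- move=> m /representable_spanning [//|f [_ fE]].
  pose B i := f (lift ord0 i) - f ord0.
  rewrite -[X in (X <= _)%N]card_ord; apply: (@card_free_family R m _ B) => l.
  have gram : forall i j, dot (B i) (B j) = (1 + (i == j)%:R) / 2.
    apply: simplex_gram => [i j ij|i]; apply: fE => //=.
  by move=> l0; apply: (simplex_free gram); rewrite l0 dot0l.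
move=> x y xy; have nxy : x != y := xy; pose A := ~: [set x; y].
have cA : #|A| = n.+1.
  by have := cardsC [set x; y]; rewrite card_ord cards2 nxy => -[].
exists #|A|; split; first by rewrite cA.
have [h hh h0] := half_sqrt R.
pose k : R := n.+1%:R; have k0 : 0 < k by rewrite ltr0n.
(* The square of [d] is the reduced discriminant [h ^+ 2 + k / 2] of the quadratic solved by [t]. *)
pose d := Num.sqrt ((1 + k) / 2).
have d2 : d ^+ 2 = (1 + k) / 2.
  by rewrite sqr_sqrtr // divr_ge0 // addr_ge0 // ltW.
have d0 : 0 < d by rewrite sqrtr_gt0 divr_gt0 // addr_gt0.
(* [t b] are the two roots of [k t^2 - 2 h t = 1/2], the condition for the
   constant vector [t] to be at distance 1 from the [h *: frame _ _ v]. *)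
pose t (b : bool) := (h + (-1) ^+ b * d) / k.
have tE b : k * t b ^+ 2 - 2 * h * t b = 1 / 2.
  have e : k * t b = h + (-1) ^+ b * d by rewrite /t mulrC divfK ?gt_eqF.
  have : ((-1) ^+ b * d) ^+ 2 = (1 + k) / 2 by rewrite exprMn sqrr_sign mul1r.
  have -> : (-1) ^+ b * d = k * t b - h by rewrite e addrC addKr.
  move=> q; apply: (mulfI (lt0r_neq0 k0)).
  transitivity ((k * t b - h) ^+ 2 - h * h); first by ring.
  by rewrite q hh; field.
pose f v : 'rV[R]_#|A| := if v == x then const_mx (t false) else
  if v == y then const_mx (t true) else h *: frame R A v.
have inA v : v != x -> v != y -> v \in A.
  by move=> vx vy; rewrite !inE negb_or vx.
have yx : y != x by rewrite eq_sym.
have apex u b : u \in A -> sqdist1 (h *: frame R A u) (const_mx (t b)).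
  move=> uA; rewrite /sqdist1 !dotE (dotC (const_mx _) (frame _ _ _)).
  rewrite dot_frame // !dot_frame_const // dot_const eqxx cA.
  rewrite mulr1 -[_ *+ n.+1]mulr_natl.
  have := tE b; lra.
have sym p q : sqdist1 p q -> sqdist1 q p.
  by rewrite /sqdist1 -(opprB q p) dotNl dotNr opprK.
have off u v : u != v -> (u, v) != (x, y) -> (u, v) != (y, x) ->
    sqdist1 (f u) (f v).
  rewrite !xpair_eqE /f => uv.
  have [ux|ux] := eqVneq u x; have [uy|uy] := eqVneq u y;
    have [vx|vx] := eqVneq v x; have [vy|vy] := eqVneq v y => //= _ _;
    try (by move: uv; rewrite ?ux ?uy ?vx ?vy eqxx);
    try (by move: nxy; rewrite -?ux -?vx ?uy ?vy eqxx);
    try (by apply/sym/apex/inA); try (by apply/apex/inA).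
  have := inA _ ux uy; have := inA _ vx vy => vA uA.
  rewrite /sqdist1 !dotE !dot_frame // !eqxx (eq_sym v) (negPf uv) /=; lra.
exists f; split=> [u v fuv|u v uv xy1 yx1]; last by apply/edist1P/off.
apply/eqP; apply: contraT => uv.
(* Distance 1 separates all other pairs; the two apexes differ because [d] is positive. *)
have tt' : const_mx (t false) != const_mx (t true) :> 'rV[R]_#|A|.
  apply/eqP => /rowP e; have := e (cast_ord (esym cA) ord0); rewrite !mxE /t.
  by move=> /(mulIf _); rewrite invr_eq0 gt_eqF // => /(_ isT) /=; lra.
have [[ux vy]|n1] := eqVneq (u, v) (x, y).
  by move: fuv tt'; rewrite /f ux vy eqxx (negPf yx) eqxx => ->; rewrite eqxx.
have [[uy vx]|n2] := eqVneq (u, v) (y, x).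
  by move: fuv tt'; rewrite /f uy vx eqxx (negPf yx) eqxx => ->; rewrite eqxx.
have := off u v uv n1 n2; rewrite /sqdist1 fuv subrr dot0l => /eqP.
by rewrite eq_sym oner_eq0.
Qed.

(** * The cycle of length four *)

Lemma edist_const (R : realType) (a b : R) :
  `|a - b| = 1 -> edist (const_mx a : 'rV_1) (const_mx b) = 1.
Proof.
by move=> e; rewrite /edist big_ord1 !mxE sqrtr_sqr.
Qed.

Lemma const_mx_inj1 (R : realType) :
  injective (fun a : R => const_mx a : 'rV_1).
Proof. by move=> a b /rowP/(_ ord0); rewrite !mxE. Qed.

(** The two diagonals are non-zero and orthogonal, which needs a plane; without an edge, the cycle
    becomes a path on consecutive integers of the line. *)
Lemma cycle4_critical (R : realType) : dimension_critical R (cycle_graph 4).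
Proof.
apply: (@dimension_critical_of_edges _ _ _ 2).
- by apply/set0Pn; exists ord0; rewrite inE.
- move=> x _; exists (ordS x).
  by case: x => -[|[|[|[|//]]]] x4.
- move=> m /representable_spanning [//|f [fi fE]].
  pose o k (lt : (k < 4)%N) : 'I_4 := Ordinal lt.
  pose f0 := f (@o 0 isT); pose f1 := f (@o 1%N isT).
  pose f2 := f (@o 2%N isT); pose f3 := f (@o 3%N isT).
  have orth : dot (f0 - f2) (f1 - f3) = 0.
    by apply: square_orthogonal; apply: fE.
  have n02 : dot (f0 - f2) (f0 - f2) != 0.
    by rewrite dot_eq0 subr_eq0 (inj_eq fi).
  have n13 : dot (f1 - f3) (f1 - f3) != 0.
    by rewrite dot_eq0 subr_eq0 (inj_eq fi).
  apply: (@free2 R m (f0 - f2) (f1 - f3)) => s t e; split.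
    have /eqP := congr1 (dot (f0 - f2)) e; rewrite dot_spanr orth mulr0 addr0.
    by rewrite dotC dot0l mulf_eq0 (negPf n02) orbF => /eqP.
  have /eqP := congr1 (dot (f1 - f3)) e; rewrite dot_spanr (dotC _ (f0 - _)).
  by rewrite orth mulr0 add0r dotC dot0l mulf_eq0 (negPf n13) orbF => /eqP.
move=> x y xy; exists 1%N; split=> //.
(* [g] counts the steps of the path left by deleting [x y], starting from the
   end [e]. *)
pose e : nat := if y == ordS x then y else x.
pose g (v : 'I_4) : nat := ((v + 4 - e) %% 4)%N.
exists (fun v => const_mx (g v)%:R); split=> [u v /const_mx_inj1 /eqP|].
  rewrite eqr_nat => /eqP; rewrite /g /e => h; apply: val_inj => /=; move: h.
  case: (y == _); case: x y u v {e g xy} => x x4 [y y4] [u u4] [v v4] /=;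
    lia.
(* A single boolean statement, so that each of the 256 cases is decided by computation. *)
have gE u v : [==> adj (cycle_graph 4) x y, adj (cycle_graph 4) u v,
    (u, v) != (x, y), (u, v) != (y, x) =>
    (g u == (g v).+1) || (g v == (g u).+1)].
  by rewrite /g /e; move: x y u v {e g xy}; do 4!case=> [[|[|[|[|//]]]] ?].
move=> u v uv n1 n2; apply: edist_const.
have {}gE := implyP (implyP (implyP (implyP (gE u v) xy) uv) n1) n2.
case/orP: gE => /eqP ->; rewrite -natr1.
  by rewrite addrAC subrr add0r normr1.
by rewrite opprD addrA subrr add0r normrN normr1.
Qed.

(** * Complete bipartite graphs with a part of size three *)

(** Comparing the second components as numbers avoids a transport between the types ['I_(p i)]. *)
Lemma tagged_ord_inj (I : finType) (p : I -> nat) (u v : {i : I & 'I_(p i)}) :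
  tag u = tag v -> tagged u = tagged v :> nat -> u = v.
Proof.
case: u v => i k [j l] /= ij; case: j / ij l => l /val_inj -> //.
Qed.

Section BipartiteThree.
Variables (R : realType) (m : nat).
Let G := complete_bipartite m.+1 3.
Let part (b : bool) : nat := if b then 3%N else m.+1.
Let vtx (b : bool) (k : 'I_(part b)) : {b : bool & 'I_(part b)} := Tagged _ k.

(** By symmetry the deleted edge can be oriented towards the part of size three. *)
Lemma bipartite3_critical (N : nat) :
  (forall n, representable R G n -> (N <= n)%N) ->
  (forall x y : {b : bool & 'I_(part b)}, tag x = false -> tag y = true ->
    exists n, (n < N)%N /\
     exists f : _ -> 'rV[R]_n, injective f /\ unit_off_edge G x y f) ->
  dimension_critical R G.
Proof.
move=> lowG edgeG; apply: (dimension_critical_of_edges _ _ lowG).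
- by apply/set0Pn; exists (@vtx true ord0); rewrite inE.
- move=> [[] k] _; first by exists (@vtx false ord0).
  by exists (@vtx true ord0).
move=> x y; rewrite /= /multipartite_adj.
case tx: (tag x); case ty: (tag y) => // _; last exact: edgeG.
have [n [nN [f [fi fE]]]] := edgeG y x ty tx.
by exists n; split=> //; exists f; split=> //; apply: unit_off_edge_sym.
Qed.

(** The three points lie on the unit sphere around a vertex of the other part, so they span a
    plane. *)
Lemma bipartite3_free n : representable R G n ->
  exists (f : _ -> 'rV[R]_n), let d k := f (@vtx true k) - f (@vtx true ord0) in
  [/\ injective f, forall x y, adj G x y -> sqdist1 (f x) (f y) &
   forall s t, s *: d (lift ord0 ord0) + t *: d ord_max = 0 -> s = 0 /\ t = 0].
Proof.
move=> /representable_spanning [//|f [fi fE]]; exists f; split=> // s t.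
by apply: (@triple_free _ _ _ _ _ (f (@vtx false ord0)));
  rewrite ?(inj_eq fi) ?eq_Tagged //; apply: fE.
Qed.
End BipartiteThree.

Lemma star_critical (R : realType) :
  dimension_critical R (complete_bipartite 1 3).
Proof.
apply: (@bipartite3_critical R 0 2) => [n /bipartite3_free [f [_ _]]|x y xf yt].
  exact: free2.
exists 1%N; split=> //.
pose idx (v : {b : bool & 'I_(if b then 3 else 1)%N}) : nat := tagged v.
pose ky := idx y.
(* The centre is at 0 and the two leaves still attached are at 1 and -1; the isolated leaf [y] goes
   to 5, an arbitrary free point. *)
pose g (v : {b : bool & 'I_(if b then 3 else 1)%N}) : R := if tag v then
  if idx v == ky then 5 else
  if idx v == (ky.+1 %% 3)%N then 1 else -1 else 0.
have ky3 : (ky < 3)%N.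
  by rewrite /ky /idx; case: (y) yt => [[] k] //= _; apply: ltn_ord.
have g1 u v : tag u = false -> tag v = true -> v <> y -> `|g u - g v| = 1.
  move=> uf vt vy; rewrite /g uf vt sub0r normrN.
  case: eqP => [e|_]; last by case: ifP => _; rewrite ?normrN normr1.
  by case: vy; apply: tagged_ord_inj e; rewrite ?vt.
exists (fun v => const_mx (g v)); split=> [u v /const_mx_inj1|u v uv n1 n2].
  rewrite /g /idx; move: u v => [[] k] [[] l] /= e.
  - apply: tagged_ord_inj => //=; have /= := ltn_ord k; have /= := ltn_ord l.
    by move: e; do ![case: ifP => ?]; move=> *; (exfalso; lra) || lia.
  - by exfalso; move: e; do ![case: ifP => ?]; lra.
  - by exfalso; move: e; do ![case: ifP => ?]; lra.
  - apply: tagged_ord_inj => //=; have /= := ltn_ord k; have /= := ltn_ord l.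
    lia.
have x0 w : tag w = false -> w = x.
  move=> wf; apply: tagged_ord_inj; rewrite ?xf // -!/(idx _).
  have idx0 z : tag z = false -> idx z = 0%N.
    by rewrite /idx; case: z => [[] k] //= _; have /= := ltn_ord k; lia.
  by rewrite !idx0.
apply: edist_const; move: uv; rewrite /= /multipartite_adj.
case ut: (tag u); case vt: (tag v) => // _.
  rewrite distrC; apply: g1 => // uy; move: n2.
  by rewrite uy (x0 v vt) eqxx.
by apply: g1 => // vy; move: n1; rewrite vy (x0 u ut) eqxx.
Qed.

(** The difference of the two vertices of the small part is orthogonal to the plane of the triple,
    which forces a third dimension. *)
Lemma K23_critical (R : realType) :
  dimension_critical R (complete_bipartite 2 3).
Proof.
apply: (@bipartite3_critical R 1 3) => [n /bipartite3_free|x y xf yt].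
  move=> [f [fi fE fr]].
  pose V k : {b : bool & 'I_(if b then 3 else 2)%N} := existT _ false k.
  apply: (free3 fr (w := f (V ord0) - f (V ord_max))).
  - by apply: square_orthogonal; apply: fE.
  - by apply: square_orthogonal; apply: fE.
  - by rewrite subr_eq0 (inj_eq fi) eq_Tagged.
exists 2%N; split=> //; have [h hh h0] := half_sqrt R.
pose idx (v : {b : bool & 'I_(if b then 3 else 2)%N}) : nat := tagged v.
pose kx := idx x; pose ky := idx y.
(* A unit rhombus, and the leaf [y] hanging from its vertex opposite to [x]. *)
pose pt (v : {b : bool & 'I_(if b then 3 else 2)%N}) : R * R := if tag v then
  if idx v == ky then (- h - 1, 0) else
  if idx v == (ky.+1 %% 3)%N then (0, h) else (0, - h) else
  if idx v == kx then (h, 0) else (- h, 0).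
pose f v : 'rV[R]_2 := \row_i if i == ord0 then (pt v).1 else (pt v).2.
have kx2 : (kx < 2)%N.
  by rewrite /kx /idx; case: (x) xf => [[] k] //= _; apply: ltn_ord.
have ky3 : (ky < 3)%N.
  by rewrite /ky /idx; case: (y) yt => [[] k] //= _; apply: ltn_ord.
have edistC u v : edist (f u) (f v) = edist (f v) (f u).
  by congr Num.sqrt; apply: eq_bigr => i _; rewrite -sqrrN opprB.
have f1 u v : tag u = false -> tag v = true -> (u, v) != (x, y) ->
    edist (f u) (f v) = 1.
  move=> uf vt uv; apply/edist1P; rewrite /dot !big_ord_recl big_ord0 !mxE /=.
  have {uv} : ~~ ((idx u == kx) && (idx v == ky)).
    apply: contraNN uv => /andP[/eqP ux /eqP vy].
    by apply/eqP; congr (_, _); apply: tagged_ord_inj => //; rewrite ?uf ?vt.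
  rewrite /pt uf vt; case: (idx u == kx); case: (idx v == ky) => //= _;
    by case: (idx v == (ky.+1 %% 3)%N) => /=; lra.
exists f; split=> [u v /rowP e|u v].
  have := e ord0; have := e ord_max; rewrite !mxE /= /pt /idx.
  move: u v {e} => [[] k] [[] l] /= e e'.
  - apply: tagged_ord_inj => //=; have /= := ltn_ord k; have /= := ltn_ord l.
    by move: e e'; do ![case: ifP => ? /=]; move=> *; (exfalso; lra) || lia.
  - by exfalso; move: e e'; do ![case: ifP => ? /=]; move=> *; lra.
  - by exfalso; move: e e'; do ![case: ifP => ? /=]; move=> *; lra.
  - apply: tagged_ord_inj => //=; have /= := ltn_ord k; have /= := ltn_ord l.
    by move: e e'; do ![case: ifP => ? /=]; move=> *; (exfalso; lra) || lia.
rewrite /= /multipartite_adj; case ut: (tag u); case vt: (tag v) => // _ n1 n2.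
  rewrite edistC f1 //; apply: contraNneq n2 => -[-> ->] //.
exact: f1.
Qed.

(** * Complete multipartite graphs with parts of size at most three *)

(* The two ends of the deleted edge share a colour, and each part splits into
   one distinguished vertex, which is the end of the edge if the part contains
   one, and the remaining ones, at most two of them, which share a colour. *)
Lemma multipartite_minus_edge (R : realType) (I : finType) (p : I -> nat)
    (x y : {i : I & 'I_(p i)}) :
  (forall i, 0 < p i <= 3)%N -> tag x != tag y ->
  exists n, (n < \sum_i (1 + (1 < p i)))%N /\
     exists f : _ -> 'rV[R]_n, injective f /\
       unit_off_edge (complete_multipartite p) x y f.
Proof.
move=> p03 xy; pose T := {i : I & 'I_(p i)}.
pose idx (v : T) : nat := tagged v.
have idx_inj u v : tag u = tag v -> idx u = idx v -> u = v.
  exact: tagged_ord_inj.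
have idx_lt v : (idx v < p (tag v))%N by apply: ltn_ord.
pose d (i : I) : nat :=
  if i == tag x then idx x else if i == tag y then idx y else 0%N.
have dp i : (d i < p i)%N.
  rewrite /d; case: eqP => [->|_] //.
  by case: eqP => [->|_] //; case/andP: (p03 i).
have dx : d (tag x) = idx x by rewrite /d eqxx.
have dy : d (tag y) = idx y by rewrite /d eqxx eq_sym (negPf xy).
pose col (v : T) : I * bool :=
  if v == y then (tag x, true) else (tag v, idx v == d (tag v)).
(* The sign separates [y] from [x], and the at most two other vertices of a part from each other: in
   a part of size three exactly one of them follows [d] cyclically. *)
pose sg (v : T) := (v == y) ||
  (idx v != d (tag v)) && (idx v == ((d (tag v)).+1 %% 3)%N).
(* The colour [(i, false)] is present only if part [i] has a vertex besides the distinguished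
   one. *)
pose B := [set c : I * bool | c.2 || (1 < p c.1)%N].
(* The distinguished vertex of its part is [y], which now has the colour of [x]: this colour is
   saved. *)
pose A := B :\ (tag y, true).
have cB : #|B| = (\sum_i (1 + (1 < p i)))%N.
  rewrite -sum1dep_card big_mkcond /=.
  rewrite -(pair_bigA _ (fun i b => if b || (1 < p i)%N then 1 else 0)%N) /=.
  by apply: eq_bigr => i _; rewrite big_bool /=; case: (1 < p i)%N.
have cA : (#|A|.+1 = #|B|)%N.
  by rewrite (cardsD1 (tag y, true) B) !inE.
have colA v : col v \in A.
  rewrite /col; have [_|vy] := eqVneq v y.
    by rewrite !inE xpair_eqE (negPf xy).
  rewrite !inE /= xpair_eqE; apply/andP; split.
    apply: contraNN vy => /andP[/eqP ty /eqP]; rewrite ty dy => /eqP e.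
    exact/eqP/idx_inj.
  by case: eqP => //= vd; have := idx_lt v; have := dp (tag v); lia.
have col_sg_inj u v : col u = col v -> sg u = sg v -> u = v.
  rewrite /col /sg.
  have [->|uy] := eqVneq u y; have [->|vy] := eqVneq v y => //=.
  - by move/eqP; rewrite xpair_eqE => /andP[_ /eqP <-].
  - by move/eqP; rewrite xpair_eqE => /andP[_ /eqP ->].
  case=> tuv; rewrite tuv => e1 e2; apply: idx_inj => //.
  have := idx_lt u; have := idx_lt v; have := dp (tag v).
  have := p03 (tag v); rewrite tuv; move: e1 e2; lia.
have [f [fi fE]] := two_per_colour R colA col_sg_inj.
exists #|A|; split; first by rewrite -cB -cA.
have off u v : tag u != tag v -> u != y -> (u, v) != (x, y) -> col u != col v.
  move=> uv uy; rewrite /col (negPf uy); have [->|vy] := eqVneq v y => n1.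
    apply: contraNneq n1 => -[ux]; rewrite ux dx => /eqP e.
    by apply/eqP; congr (_, _); apply: idx_inj.
  by rewrite xpair_eqE (negPf uv).
exists f; split=> // u v uv n1 n2; apply: fE.
have [uy|uy] := eqVneq u y; last exact: off.
rewrite eq_sym; apply: off; first by rewrite eq_sym.
  by apply: contraTneq uv => ->; rewrite uy adj_irrefl.
by apply: contraNneq n2 => -[-> ->].
Qed.

Lemma multipartite_critical (R : realType) (alpha gamma : nat) :
  (2 <= gamma)%N -> dimension_critical R (multipartite_123 alpha 0 gamma).
Proof.
move=> g2; pose p := @part_size_123 alpha 0 gamma.
pose T := {i & 'I_(p i)}.
pose i0 : 'I_gamma := Ordinal (ltnW g2); pose i1 : 'I_gamma := Ordinal g2.
pose A j : T := existT (fun i => 'I_(p i)) (inl (inl j)) ord0.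
pose X j k : T := existT (fun i => 'I_(p i)) (inr j) k.
apply: (@dimension_critical_of_edges _ _ _ (alpha + gamma * 2)).
- by apply/set0Pn; exists (X i0 ord0); rewrite inE.
- move=> x _; have [xi|xi] := eqVneq (tag x) (inr i0).
    by exists (X i1 ord0); rewrite /= /multipartite_adj xi.
  by exists (X i0 ord0).
- move=> m /representable_spanning [//|f [fi fE]].
  apply: (@multipartite_bound R m _ _ (f \o A) (fun j => f \o X j)) => //.
  - by move=> i j ij; apply: fE.
  - by move=> i j k; apply: fE.
  - by move=> i j k l ij; apply: fE.
  - move=> i k l /fi /eqP; rewrite eq_Tagged => /eqP //.
move=> x y xy.
have [|n [nN fE]] := @multipartite_minus_edge R _ p x y _ xy.
  by move=> [[i|[]]|i].
exists n; split=> //; apply: leq_trans nN _.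
(* A singleton counts for one colour and a triple for two, so the sum is the lower bound
   [alpha + gamma * 2]. *)
rewrite !big_sumType /= big_ord0 addn0 !sum_nat_const !card_ord; lia.
Qed.

Theorem theorem2p3 (R : realType) :
  (forall alpha : nat, (3 <= alpha)%N ->
     dimension_critical R (complete_graph alpha)) /\
  dimension_critical R (cycle_graph 4) /\
  dimension_critical R (complete_bipartite 1 3) /\
  dimension_critical R (complete_bipartite 2 3) /\
  (forall alpha gamma : nat, (2 <= gamma)%N ->
     dimension_critical R (multipartite_123 alpha 0 gamma)).
Proof.
split; first by case=> [|[|[|n]]] // _; apply: complete_critical.
split; first exact: cycle4_critical.
split; first exact: star_critical.
split; first exact: K23_critical.
exact: multipartite_critical.
Qed.
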